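(* Fix $k$ and $d$. For every $\alpha,\varepsilon>0$ there is $\delta=\delta(d,\alpha,\varepsilon)>0$ (also allowed to depend on $k$) such that the following holds. Let $E\subseteq V_1\times\cdots\times V_k$ be a $k$-hypergraph of VC-dimension at most $d$, for $i=1,\ldots,k$ let $\mathcal B_i$ be a field on $V_i$ containing all fibres $E_b$, $b\in V_{i^\circ}$, and let $\mu_i$ be a measure on $\mathcal B_i$ which is fap on $E$. Let $\mu=\mu_1\ltimes\cdots\ltimes\mu_k$. If $\mu(E)\ge\alpha$, then there are $E$-definable sets $A_i\subseteq V_i$ with $\mu_i(A_i)>\delta$ for all $i=1,\ldots,k$ and $d_E(A_1,\ldots,A_k)>1-\varepsilon$, where $d_E(A_1,\ldots,A_k)=\frac{\mu(E\cap(A_1\times\cdots\times A_k))}{\mu_1(A_1)\cdots\mu_k(A_k)}$.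
   Context: Notation: $[k]=\{1,\ldots,k\}$; for $I\subseteq[k]$, $I^\circ=[k]\setminus I$, $i^\circ=[k]\setminus\{i\}$, $V_I=\prod_{i\in I}V_i$; viewing $E$ as a subset of $V_I\times V_{I^\circ}$, the fibre of $b\in V_{I^\circ}$ is $E_b=\{a\in V_I:(a,b)\in E\}$. A subset of $V_i$ is $E$-definable if it is a finite Boolean combination of fibres $E_b$, $b\in V_{i^\circ}$. $E$ has VC-dimension at most $d$ if for every $I\subseteq[k]$ the family $\{E_a:a\in V_{I^\circ}\}$ of subsets of $V_I$ has VC-dimension at most $d$. A field is a Boolean algebra of subsets; a measure is a finitely additive probability measure on a field. $\mu_i$ is fap on $E$ if for every $m$ and every $\varepsilon>0$ there are $p_1,\ldots,p_n\in V_i$ (repetitions allowed) with $|\mu_i(F)-\frac1n|\{j:p_j\in F\}||<\varepsilon$ for every Boolean combination $F$ of at most $m$ fibres $E_b$, $b\in V_{i^\circ}$. Product measure: for measures $\mu$ on a field on $V$ (fap on the relation) and $\nu$ on a field on $W$, $\mu\ltimes\nu$ is the unique finitely additive probability measure on the field generated by products of measurable sets and the relevant definable sets of the relation, extending $\mu(A)\nu(B)$ on boxes and with $(\mu\ltimes\nu)(D\cap(A\times B))=\int_B\mu(A\cap D_y)\,d\nu(y)$ for definable $D$ (integration of uniform limits of simple functions w.r.t. finitely additive measures); $\mu_1\ltimes\cdots\ltimes\mu_k=(\mu_1\ltimes\cdots\ltimes\mu_{k-1})\ltimes\mu_k$. *)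

(* Defs.v *)
(* MathComp-Analysis; the real numbers are an arbitrary [R : realType]. *)
From HB Require Import structures.
From mathcomp Require Import all_boot all_order all_algebra.
From mathcomp Require Import all_classical all_reals all_analysis.

Set Implicit Arguments.
Unset Strict Implicit.
Unset Printing Implicit Defensive.

Import Order.TTheory GRing.Theory Num.Theory.
Import numFieldNormedType.Exports.
Local Open Scope classical_set_scope.
Local Open Scope card_scope.
Local Open Scope ring_scope.

(* ---------- Fields of sets and Boolean combinations ---------- *)

Definition set_field (X : Type) (G : set (set X)) : Prop :=
  [/\ G set0, setU_closed G & setC_closed G].

(* The sets in the field generated by a finite family S_0, ..., S_(n-1) are
   exactly the Boolean combinations of the S_j. *)
Definition bool_comb_of_at_most (X : Type) (m : nat) (G : set (set X))
    (F : set X) : Prop :=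
  exists (n : nat) (S : 'I_n -> set X),
    [/\ (n <= m)%N, range S `<=` G & smallest (@set_field X) (range S) F].

Definition finite_bool_comb (X : Type) (G : set (set X)) : set (set X) :=
  [set F | exists m : nat, bool_comb_of_at_most m G F].

(* ---------- Finitely additive probability measures ---------- *)

(* A measure is a real function on all subsets, of which only the values on
   the field G are constrained (and ever used). *)
Definition fa_prob (R : realType) (X : Type) (G : set (set X))
    (mu : set X -> R) : Prop :=
  [/\ set_field G,
      forall A, G A -> 0 <= mu A,
      mu setT = 1 &
      forall A B, G A -> G B -> A `&` B = set0 -> mu (A `|` B) = mu A + mu B].

(* The function \sum_j c_j 1_(S_j), with S_j in G. *)
Record simple_fun (R : realType) (X : Type) (G : set (set X)) := SimpleFun {
  sf_size : nat;
  sf_coef : 'I_sf_size -> R;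
  sf_set : 'I_sf_size -> set X;
  sf_setP : forall j, G (sf_set j) }.

Definition sf_eval (R : realType) (X : Type) (G : set (set X))
    (s : simple_fun R G) (x : X) : R :=
  \sum_(j < sf_size s) sf_coef j * \1_(sf_set j) x.

Definition sf_integral (R : realType) (X : Type) (G : set (set X))
    (mu : set X -> R) (s : simple_fun R G) : R :=
  \sum_(j < sf_size s) sf_coef j * mu (sf_set j).

(* f is a uniform limit of G-simple functions, and v is its integral. *)
Definition has_integral (R : realType) (X : Type) (G : set (set X))
    (mu : set X -> R) (f : X -> R) (v : R) : Prop :=
  exists s : nat -> simple_fun R G,
    (forall e : R, 0 < e ->
       \forall n \near \oo, forall x, `|sf_eval (s n) x - f x| < e) /\
    ((fun n => sf_integral mu (s n)) @ \oo --> v).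

(* ---------- Fibres and products ---------- *)

(* Throughout, maps p : T -> X and q : T -> Y for which (p, q) is a bijection
   present T as the product X * Y. For D a subset of T, [fibre p q D y] is
   then D_y = {x | (x, y) \in D}. *)
Definition fibre (T X Y : Type) (p : T -> X) (q : T -> Y) (D : set T) (y : Y)
    : set X :=
  [set p t | t in [set t | D t /\ q t = y]].

Definition box (T X Y : Type) (p : T -> X) (q : T -> Y) (A : set X) (B : set Y)
    : set T :=
  (p @^-1` A) `&` (q @^-1` B).

Definition ltimes_field (T X Y : Type) (p : T -> X) (q : T -> Y)
    (Def : set (set T)) (GX : set (set X)) (GY : set (set Y)) : set (set T) :=
  smallest (@set_field T)
    (Def `|` [set C | exists A B, [/\ GX A, GY B & C = box p q A B]]).

(* pmu is the product of mu on GX by nu on GY; Def is the collection of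
   definable subsets of T = X * Y. The integral over B is that of the
   integrand times the indicator of B. *)
Definition is_ltimes (R : realType) (T X Y : Type) (p : T -> X) (q : T -> Y)
    (Def : set (set T)) (GX : set (set X)) (mu : set X -> R)
    (GY : set (set Y)) (nu : set Y -> R) (pmu : set T -> R) : Prop :=
  [/\ fa_prob (ltimes_field p q Def GX GY) pmu,
      forall A B, GX A -> GY B -> pmu (box p q A B) = mu A * nu B &
      forall D A B, Def D -> GX A -> GY B ->
        has_integral GY nu (fun y => \1_B y * mu (A `&` fibre p q D y))
          (pmu (D `&` box p q A B))].

(* ---------- Hypergraphs ---------- *)

(* [k] is 'I_k, numbered from 0; a k-hypergraph on V_0, ..., V_(k-1) is a set
   of dependent functions x with x i : V i. *)

(* V_I *)
Definition subprod (k : nat) (V : 'I_k -> Type) (I : {set 'I_k}) : Type :=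
  forall i : {i : 'I_k | i \in I}, V (sval i).

Definition restr (k : nat) (V : 'I_k -> Type) (I : {set 'I_k})
    (x : forall i, V i) : subprod V I :=
  fun i => x (sval i).
Arguments restr {k V} I x.

Definition subrestr (k : nat) (V : 'I_k -> Type) (I J : {set 'I_k})
    (IJ : I \subset J) (x : subprod V J) : subprod V I :=
  fun i => x (exist _ (sval i) (fintype.subsetP IJ _ (svalP i))).

(* The fibre E_b, a subset of V_I, of b in V_(~: I). *)
Definition fibre_on (k : nat) (V : 'I_k -> Type) (E : set (forall i, V i))
    (I : {set 'I_k}) (b : subprod V (~: I)%SET) : set (subprod V I) :=
  fibre (restr I) (restr (~: I)%SET) E b.
Arguments fibre_on {k V} E I b.

(* The fibre E_b as a subset of V_i itself rather than of V_{ {i} }. *)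
Definition fibre_at (k : nat) (V : 'I_k -> Type) (E : set (forall i, V i))
    (i : 'I_k) (b : subprod V (~: [set i])%SET) : set (V i) :=
  fibre (fun x : forall i, V i => x i) (restr (~: [set i])%SET) E b.
Arguments fibre_at {k V} E i b.

Definition definable_on (k : nat) (V : 'I_k -> Type)
    (E : set (forall i, V i)) (I : {set 'I_k}) : set (set (subprod V I)) :=
  finite_bool_comb (range (fibre_on E I)).
Arguments definable_on {k V} E I _.

Definition definable_at (k : nat) (V : 'I_k -> Type)
    (E : set (forall i, V i)) (i : 'I_k) : set (set (V i)) :=
  finite_bool_comb (range (fibre_at E i)).
Arguments definable_at {k V} E i _.

Definition shatters (X : Type) (F : set (set X)) (S : set X) : Prop :=
  forall S', S' `<=` S -> exists2 A, F A & A `&` S = S'.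

Definition vc_dim_le (X : Type) (F : set (set X)) (d : nat) : Prop :=
  forall (n : nat) (S : set X), S #= `I_n -> shatters F S -> (n <= d)%N.

Definition hypergraph_vc_dim_le (k : nat) (V : 'I_k -> Type)
    (E : set (forall i, V i)) (d : nat) : Prop :=
  forall I : {set 'I_k}, vc_dim_le (range (fibre_on E I)) d.

Definition fap (R : realType) (k : nat) (V : 'I_k -> Type)
    (E : set (forall i, V i)) (i : 'I_k) (mu : set (V i) -> R) : Prop :=
  forall (m : nat) (eps : R), 0 < eps ->
    exists (n : nat) (p : 'I_n -> V i), (0 < n)%N /\
      forall F, bool_comb_of_at_most m (range (fibre_at E i)) F ->
        `|mu F - #|[pred j | p j \in F]|%:R / n%:R| < eps.

(* ---------- The iterated product mu_0 |x ... |x mu_(k-1) ---------- *)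

Definition prefix_set (k j : nat) : {set 'I_k} :=
  finset (fun i : 'I_k => (i < j)%N).

Lemma prefix_setS (k : nat) (i : 'I_k) :
  prefix_set k i \subset prefix_set k i.+1.
Proof. by apply/fintype.subsetP => j; rewrite !inE => /ltnW. Qed.

Lemma mem_prefix_setS (k : nat) (i : 'I_k) : i \in prefix_set k i.+1.
Proof. by rewrite inE. Qed.

(* The two projections presenting V_0 * ... * V_i as
   (V_0 * ... * V_(i-1)) * V_i. *)
Definition prefix_init (k : nat) (V : 'I_k -> Type) (i : 'I_k)
    (x : subprod V (prefix_set k i.+1)) : subprod V (prefix_set k i) :=
  subrestr (prefix_setS i) x.

Definition prefix_last (k : nat) (V : 'I_k -> Type) (i : 'I_k)
    (x : subprod V (prefix_set k i.+1)) : V i :=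
  x (exist _ i (mem_prefix_setS i)).

(* [iterated_ltimes E B mu pmu]: pmu is the product of the measures mu i on the
   fields B i. F j and M j are the field and the measure on the product of the
   first j factors. The recursion starts at the unique measure on the
   one-point empty product, whose product with mu_0 is mu_0; [restr] identifies
   the full product with V_[k]. *)
Definition iterated_ltimes (R : realType) (k : nat) (V : 'I_k -> Type)
    (E : set (forall i, V i)) (B : forall i, set (set (V i)))
    (mu : forall i, set (V i) -> R) (pmu : set (forall i, V i) -> R) : Prop :=
  exists (F : forall j : nat, set (set (subprod V (prefix_set k j))))
         (M : forall j : nat, set (subprod V (prefix_set k j)) -> R),
    [/\ F 0%N = setT /\ fa_prob (F 0%N) (M 0%N),
        forall i : 'I_k,
          F i.+1 = ltimes_field (@prefix_init k V i) (@prefix_last k V i)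
                     (definable_on E (prefix_set k i.+1)) (F i) (B i) /\
          is_ltimes (@prefix_init k V i) (@prefix_last k V i)
            (definable_on E (prefix_set k i.+1))
            (F i) (M i) (B i) (mu i) (M i.+1) &
        forall S : set (subprod V (prefix_set k k)),
          pmu (restr (prefix_set k k) @^-1` S) = M k S].

(* d_E(A_0, ..., A_(k-1)) *)
Definition edge_density (R : realType) (k : nat) (V : 'I_k -> Type)
    (E : set (forall i, V i)) (mu : forall i, set (V i) -> R)
    (pmu : set (forall i, V i) -> R) (A : forall i, set (V i)) : R :=
  pmu (E `&` [set x | forall i, A i (x i)]) / \prod_(i < k) mu i (A i).

(* Main.v *)
(* The proof is by induction on the number j of coordinates: if every section of
   E in V_1 x ... x V_j of measure at least alpha / 3 contains a dense definable
   box, so does every section D in V_1 x ... x V_(j+1) of measure at least alpha.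
   The product measure on V_1 x ... x V_j is approximated on symmetric
   differences of sections by counting on a finite sample. By bounded
   VC-dimension, boundedly many balls around points z_l of V_(j+1), for the
   sampled distance between the sections D_y, cover V_(j+1); one of them has
   measure bounded below and a centre with M_j(D_(z_l)) >= alpha / 3. A dense box
   of D_(z_l) times this ball is a dense box of D. Balls are definable because
   they only depend on the finitely many fibres over the sample; the size of the
   sample is not bounded in terms of d, but the number of balls is. *)
Require Import Defs.
From HB Require Import structures.
From mathcomp Require Import all_boot all_order all_algebra.
From mathcomp Require Import all_classical all_reals all_analysis.
From mathcomp Require Import zify lra ring.

Set Implicit Arguments.
Unset Strict Implicit.
Unset Printing Implicit Defensive.

Import Order.TTheory GRing.Theory Num.Theory.
Import numFieldNormedType.Exports.
Local Open Scope classical_set_scope.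
Local Open Scope ring_scope.

(** * Sauer-Shelah and packing for finite samples *)

Definition tsection (m : nat) (b : bool) (A : {set m.+1.-tuple bool}) :
    {set m.-tuple bool} :=
  [set v : m.-tuple bool | [tuple of b :: v] \in A]%SET.

Lemma card_tsection (m : nat) (A : {set m.+1.-tuple bool}) :
  #|A| = (#|tsection true A| + #|tsection false A|)%N.
Proof.
pose c b (v : m.-tuple bool) : m.+1.-tuple bool := [tuple of b :: v].
have ci b : injective (c b).
  by move=> u v /(congr1 val) [] /val_inj.
have AE : A = (c true @: tsection true A :|: c false @: tsection false A)%SET.
  apply/setP => u; apply/idP/setUP => [uA|].
    case: (tupleP u) uA => b v uA.
    by case: b uA => uA; [left|right]; apply/imsetP; exists v; rewrite ?inE.
  by case=> /imsetP[v]; rewrite inE => vA ->.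
rewrite [in LHS]AE cardsU !card_imset // (_ : (_ :&: _)%SET = finset.set0).
  by rewrite cards0 subn0.
apply/setP => u; rewrite !inE; apply/negP => /andP[].
by move=> /imsetP[v _ ->] /imsetP[w _ /(congr1 val)].
Qed.

(** A mask of coordinates plays the role of the shattered set. Split [A] by its first bit into two
    sections: if their union is large, the first coordinate is skipped; otherwise their intersection
    is large and the first coordinate joins the mask. *)
Lemma sauer_shelah (m d : nat) (A : {set m.-tuple bool}) :
  ((m.+1 ^ d) < #|A|)%N ->
  exists msk : bitseq, [/\ size msk = m, count id msk = d.+1 &
    forall w : bitseq, size w = d.+1 -> exists2 v, v \in A & mask msk v = w].
Proof.
elim: m d A => [|m IH] d A ltA.
  move: ltA; rewrite exp1n ltnNge.
  by rewrite (leq_trans (max_card _)) // card_tuple expn0.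
pose At := tsection true A; pose Af := tsection false A.
have cA : #|A| = (#|At :|: Af| + #|At :&: Af|)%N.
  by rewrite card_tsection cardsUI.
have [ltU|leU] := ltnP (m.+1 ^ d) #|At :|: Af|%SET.
  have [msk [sm cm wm]] := IH d _ ltU.
  exists (false :: msk); split=> /=; rewrite ?sm ?cm //.
  move=> w sw; have [v /setUP[] vA vw] := wm w sw.
  - by exists [tuple of true :: v] => //; move: vA; rewrite inE.
  - by exists [tuple of false :: v] => //; move: vA; rewrite inE.
have lift w (v : m.-tuple bool) : v \in (At :&: Af)%SET ->
    exists2 u, u \in A & u = w :: v :> bitseq.
  rewrite !inE => /andP[vt vf]; case: w.
  - by exists [tuple of true :: v].
  - by exists [tuple of false :: v].
case: d ltA leU => [|d] ltA leU.
  have /card_gt0P[v vI] : (0 < #|At :&: Af|%SET)%N.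
    by move: ltA leU; rewrite cA !expn0; lia.
  exists (true :: nseq m false); split=> /=.
  - by rewrite size_nseq.
  - by rewrite count_nseq mul0n.
  move=> [|b [|? ?]] // _; have [u uA uE] := lift b v vI.
  by exists u => //; rewrite uE /= mask_false.
(* [m.+2 ^ d.+1] equals [m.+2 ^ d + m.+1 * m.+2 ^ d], and the union accounts for at most
   [m.+1 ^ d.+1]. *)
have ltI : (m.+1 ^ d < #|At :&: Af|%SET)%N.
  move: ltA leU; rewrite cA.
  have : (m.+2 ^ d.+1 >= m.+1 ^ d.+1 + m.+1 ^ d)%N.
    have le_exp : (m.+1 ^ d <= m.+2 ^ d)%N by case: (d) => // n; rewrite leq_exp2r.
    by rewrite !expnS [(m.+2 * _)%N]mulSn addnC leq_add // leq_mul.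
  lia.
have [msk [sm cm wm]] := IH d _ ltI.
exists (true :: msk); split=> /=; rewrite ?sm ?cm //.
move=> [|b w] // [sw]; have [v vI vw] := wm w sw.
have [u uA uE] := lift b v vI.
by exists u => //; rewrite uE /= vw.
Qed.

(* Each new sample point separates at least a proportion [e] of the pairs not yet
   separated, by averaging over all points. *)
Lemma separating_sample (R : realType) (e : R) (T : finType) (N : nat)
    (b : 'I_N -> T -> bool) (m : nat) :
  0 <= e -> e <= 1 -> (0 < #|T|)%N ->
  (forall i j : 'I_N, i != j -> e * #|T|%:R <= #|[pred t | b i t != b j t]|%:R) ->
  exists u : m.-tuple T,
    #|[pred p : 'I_N * 'I_N |
        (p.1 != p.2) && all (fun t => b p.1 t == b p.2 t) u]|%:R <=
    (1 - e) ^+ m * (N ^ 2)%:R.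
Proof.
move=> e0 e1 T0 sep; elim: m => [|m [u uP]].
  exists [tuple] => /=; rewrite expr0 mul1r ler_nat.
  by rewrite (leq_trans (max_card _)) // card_prod card_ord.
set U := [pred p : _ * _ | _] in uP.
pose S t := [pred p : 'I_N * 'I_N | U p && (b p.1 t != b p.2 t)].
have [t St] : exists t, e * #|U|%:R <= #|S t|%:R.
  apply: contrapT => /forallNP noS.
  have : \sum_(t : T) #|S t|%:R < \sum_(t : T) (e * #|U|%:R).
    have [t0 _] := card_gt0P T0; apply: ltr_sum.
      by apply/hasP; exists t0 => //; rewrite mem_index_enum.
    by move=> t _; rewrite real_ltNge ?num_real //; exact/negP/noS.
  rewrite sumr_const -(mulr_natr (e * _)) real_ltNge ?num_real // => /negP; apply.
  (* Double counting of the pairs in [U] together with a point of [T] separating them. *)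
  have -> : \sum_(t : T) #|S t|%:R =
            \sum_(p in U) #|[pred t | b p.1 t != b p.2 t]|%:R :> R.
    rewrite -!natr_sum; congr (_%:R).
    under eq_bigr do rewrite -sum1_card big_mkcond.
    rewrite exchange_big [RHS]big_mkcond /=; apply: eq_bigr => p _.
    rewrite -topredE; case: ifP => Up.
      rewrite -sum1_card [RHS]big_mkcond; apply: eq_bigr => t _.
      by rewrite inE [U p]Up.
    by rewrite big1 // => t _; rewrite inE [U p]Up.
  apply: (@le_trans _ _ (\sum_(p in U) (e * #|T|%:R))).
    by rewrite sumr_const -(mulr_natr (e * _)) mulrAC.
  by apply: ler_sum => p /andP[pn _]; exact: sep.
exists [tuple of t :: u].
set U' := [pred p : _ * _ | _].
have cU : (#|U| = #|S t| + #|U'|)%N.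
  rewrite -(cardID (S t) U); congr (_ + _)%N; apply: eq_card => p.
    by rewrite !inE /=; case: (p.1 != p.2); case: (all _ _); rewrite ?andbF ?andbT.
  by rewrite !inE /=; case: (p.1 != p.2); case: (all _ _); case: eqP.
apply: (@le_trans _ _ ((1 - e) * #|U|%:R)).
  by move: St; rewrite cU natrD; lra.
by rewrite exprS -mulrA ler_wpM2l // subr_ge0.
Qed.

(** Exponential decay beats polynomial growth. Here [m.+1 ^ d] is the Sauer-Shelah bound on [m]
    points; with one set more than that, less than one pair stays unseparated after [m] samples. *)
Lemma exprn_poly_small (R : realType) (e : R) (d : nat) :
  0 < e -> e <= 1 -> exists m : nat, (1 - e) ^+ m * ((m.+1 ^ d).+1 ^ 2)%:R < 1.
Proof.
move=> e0 e1.
(* For [m > K] the term of degree [n.+1] of the exponential series at [e * m] exceeds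
   [4 * 2 ^ n * m ^ n], which bounds the polynomial factor once [m >= 1]. *)
pose n := (2 * d)%N; pose K : R := (4 * 2 ^ n * n.+1`!)%:R / e ^+ n.+1.
have K0 : 0 <= K by rewrite divr_ge0 // exprn_ge0 // ltW.
pose m := (Num.bound K).+1; exists m.
have mK : K < m%:R.
  by apply: (lt_trans (archi_boundP K0)); rewrite ltr_nat.
have em0 : 0 < expR (e * m%:R) :> R by exact: expR_gt0.
have le_exp : (1 - e) ^+ m <= (expR (e * m%:R))^-1.
  rewrite -expRN -mulNr mulrC expRM_natl lerXn2r ?nnegrE ?subr_ge0 ?expR_ge0 //.
  exact: expR_ge1Dx.
have le_poly : (((m.+1 ^ d).+1 ^ 2)%:R : R) <= (4 * 2 ^ n)%:R * m%:R ^+ n.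
  rewrite -natrX -natrM ler_nat -mulnA -expnMn /n (mulnC 2%N d) expnM.
  rewrite (_ : 4 = 2 ^ 2)%N // -expnMn.
  rewrite leq_exp2r //.
  have : (m.+1 ^ d <= (2 * m) ^ d)%N by case: (d) => // d'; rewrite leq_exp2r //; lia.
  have : (0 < m.+1 ^ d)%N by rewrite expn_gt0.
  lia.
have m0 : 0 < m%:R :> R by rewrite ltr0n.
have gt_exp : (e * m%:R) ^+ n.+1 / n.+1`!%:R < expR (e * m%:R).
  have := @expR_ge1Dxn R (e * m%:R) n (mulr_ge0 (ltW e0) (ltW m0)).
  by apply: lt_le_trans; rewrite ltrDr.
apply: le_lt_trans (ler_pM _ _ le_exp le_poly) _ => //.
  by rewrite exprn_ge0 // subr_ge0.
rewrite mulrC ltr_pdivrMr // mul1r; apply: lt_trans gt_exp.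
rewrite ltr_pdivlMr ?ltr0n ?fact_gt0 // exprMn [m%:R ^+ n.+1]exprS [ltRHS]mulrA.
rewrite [ltLHS]mulrAC ltr_pM2r ?exprn_gt0 // -natrM.
by rewrite mulrC -ltr_pdivrMr ?exprn_gt0.
Qed.

(** Distance at least [e] in the normalised Hamming distance of traces on the sample [P], repeated
    sample points being counted with multiplicity. *)
Definition sample_separated (R : realType) (X Y : Type) (T : finType) (e : R)
    (P : T -> X) (S : Y -> set X) (y z : Y) : bool :=
  e * #|T|%:R <= #|[pred t | `[< S y (P t) >] != `[< S z (P t) >]]|%:R.

(** Since all bit patterns along [s] are realised, its entries are distinct, so they form a
    shattered set of [n] elements. *)
Lemma shattered_size (X : Type) (F : set (set X)) (d n : nat) (s : seq X) :
  vc_dim_le F d -> size s = n ->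
  (forall w : bitseq, size w = n ->
     exists2 A, F A & map (fun x => `[< A x >]) s = w) ->
  (n <= d)%N.
Proof.
case: s => [|x0 s] vcF; first by move=> <-.
move: {s}(x0 :: s) => s sn realize.
have bit w A q : (q < n)%N -> map (fun x => `[< A x >]) s = w ->
    `[< A (nth x0 s q) >] = nth false w q.
  by move=> qn <-; rewrite (nth_map x0) ?sn.
apply: (vcF n (nth x0 s @` `I_n)).
  apply: inj_card_eq => p q; rewrite !inE /= => pn qn epq.
  have [A _ Aw] := realize (mkseq (fun r => r == p) n) (size_mkseq _ _).
  have := bit _ _ _ pn Aw; rewrite epq (bit _ _ _ qn Aw) !nth_mkseq // eqxx.
  by move=> /eqP.
move=> S' S'sub.
have [A FA Aw] := realize (mkseq (fun r => `[< S' (nth x0 s r) >]) n)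
                         (size_mkseq _ _).
exists A => //; apply/seteqP; split=> x.
  case=> Ax [q /= qn qx]; move: Ax; rewrite -qx => /asboolP.
  by rewrite (bit _ _ _ qn Aw) nth_mkseq // => /asboolP.
move=> S'x; have [q /= qn qx] := S'sub _ S'x; split; last by exists q.
move: S'x; rewrite -qx => S'x; apply/asboolP.
by rewrite (bit _ _ _ qn Aw) nth_mkseq //; exact/asboolP.
Qed.

(** A packing bound of Haussler's type. Among [(m.+1 ^ d).+1] pairwise separated sets, some [m]
    sample points already tell all of them apart, and Sauer-Shelah then gives [d.+1] shattered
    points. The bound [N] does not depend on the size of the sample. *)
Lemma vc_packing (R : realType) (d : nat) (e : R) : 0 < e -> e <= 1 ->
  exists N : nat, forall (X Y : Type) (T : finType) (P : T -> X)
    (S : Y -> set X), (0 < #|T|)%N -> vc_dim_le (range S) d ->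
    forall s : seq Y, pairwise (sample_separated e P S) s -> (size s <= N)%N.
Proof.
move=> e0 e1; have [m mP] := exprn_poly_small d e0 e1.
exists (m.+1 ^ d)%N => X Y T P S T0 vcS s sP; rewrite leqNgt; apply/negP => ltNs.
pose M := (m.+1 ^ d).+1; pose s' := take M s.
have sM : size s' = M by rewrite size_takel.
have s'P : pairwise (sample_separated e P S) s'.
  by move: sP; rewrite -(cat_take_drop M s) pairwise_cat => /and3P[].
have [y0 _] : exists y0 : Y, True by case: (s) ltNs => // y ? _; exists y.
pose b (i : 'I_M) t := `[< S (nth y0 s' i) (P t) >].
have sep (i j : 'I_M) : i != j -> e * #|T|%:R <= #|[pred t | b i t != b j t]|%:R.
  have lt_sep (p q : 'I_M) : (p < q)%N -> e * #|T|%:R <= #|[pred t | b p t != b q t]|%:R.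
    by move=> pq; have /(pairwiseP y0) := s'P; apply; rewrite ?inE ?sM.
  rewrite -val_eqE neq_ltn => /orP[/lt_sep//|/lt_sep].
  have -> // : #|[pred t | b j t != b i t]| = #|[pred t | b i t != b j t]|.
  by apply: eq_card => t; rewrite !inE eq_sym.
have [u uP] := separating_sample m (ltW e0) e1 T0 sep.
(* Two equal traces would be an unseparated pair, while the number of such pairs is below 1. *)
have tr_inj : injective (fun i => map_tuple (b i) u).
  move=> i j /(congr1 val) /= tij; apply: contrapT => /eqP nij.
  have := le_lt_trans uP mP; rewrite -[1]/(1%:R) ltr_nat ltnNge => /negP; apply.
  apply/card_gt0P; exists (i, j); rewrite inE /= nij /=.
  by apply/allP => t tu; apply/eqP; exact: (eq_in_map _ _ _).2 tij t tu.
have [|msk [sm cm wm]] := @sauer_shelah m d [set map_tuple (b i) u | i : 'I_M]%SET.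
  by rewrite card_imset // card_ord.
have : (d.+1 <= d)%N; last by rewrite ltnn.
apply: (@shattered_size _ _ d d.+1 (mask msk (map P u)) vcS).
  by rewrite size_mask ?cm // size_map size_tuple sm.
move=> w sw; have [v /imsetP[i _ ->] vw] := wm w sw.
exists (S (nth y0 s' i)); first by exists (nth y0 s' i).
by rewrite map_mask -map_comp -vw.
Qed.

(** To a pairwise related list of greatest length no [y] can be prepended. *)
Lemma maximal_pairwise (Y : Type) (r : rel Y) (N : nat) :
  (forall s, pairwise r s -> (size s <= N)%N) ->
  exists2 s, (size s <= N)%N & forall y, has (fun z => ~~ r y z) s.
Proof.
elim: N => [|N IH] bnd.
  exists [::] => // y.
  by have /(_ isT) := bnd [:: y].
have [[s sr sN]|no_s] := pselect (exists2 s, pairwise r s & size s = N.+1).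
  exists s; first by rewrite sN.
  move=> y; rewrite has_predC; apply/negP => ry.
  by have := bnd (y :: s); rewrite /= ry sr sN ltnn => /(_ isT).
have [s sr|s sN cov] := IH; last by exists s => //; exact: leqW.
by have := bnd s sr; rewrite leq_eqVlt => /orP[/eqP sN|//]; case: no_s; exists s.
Qed.

Lemma vc_cover (R : realType) (d : nat) (e : R) : 0 < e -> e <= 1 ->
  exists N : nat, forall (X Y : Type) (T : finType) (P : T -> X)
    (S : Y -> set X), (0 < #|T|)%N -> vc_dim_le (range S) d ->
    exists (n : nat) (z : 'I_n -> Y), (n <= N)%N /\
      forall y, exists l, ~~ sample_separated e P S y (z l).
Proof.
move=> e0 e1; have [N NP] := vc_packing d e0 e1.
exists N => X Y T P S T0 vcS.
have [s sN cov] := maximal_pairwise (NP X Y T P S T0 vcS).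
exists (size s), (tnth (in_tuple s)); split=> // y.
by have /(@has_tnthP _ _ _ (in_tuple s))[l yl] := cov y; exists l.
Qed.

(** * Finitely additive integration *)

Lemma set_fieldT (X : Type) (G : set (set X)) : set_field G -> G setT.
Proof. by case=> G0 _ GC; rewrite -setC0; exact: GC. Qed.

Lemma set_fieldI (X : Type) (G : set (set X)) (A B : set X) :
  set_field G -> G A -> G B -> G (A `&` B).
Proof.
case=> _ GU GC GA GB; rewrite -[A `&` B]setCK setCI.
by apply: (GC); apply: (GU); apply: (GC).
Qed.

Lemma set_fieldD (X : Type) (G : set (set X)) (A B : set X) :
  set_field G -> G A -> G B -> G (A `\` B).
Proof.
move=> Gf GA GB; rewrite setDE; apply: set_fieldI => //.
by case: Gf => _ _; apply.
Qed.

Lemma set_fieldY (X : Type) (G : set (set X)) (A B : set X) :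
  set_field G -> G A -> G B -> G (A `+` B).
Proof. by move=> Gf GA GB; case: (Gf) => _ GU _; apply: GU; exact: set_fieldD. Qed.

Lemma set_field_smallest (X : Type) (S : set (set X)) :
  set_field (smallest (@set_field X) S).
Proof.
split.
- by move=> G [[]].
- move=> A B GA GB G GS; case: (GS) => -[_ GU _] _.
  by apply: GU; [exact: GA|exact: GB].
- by move=> A GA G GS; case: (GS) => -[_ _ GC] _; apply: GC; exact: GA.
Qed.

(** Such a [C] is a union of atoms of finitely many members of [G]. By induction on the list, [C] is
    cut along [S s], and each half is cut out by a set determined by the remaining members. This
    yields definability without an explicit Boolean formula. *)
Lemma set_field_determined (X : Type) (G : set (set X)) (T : eqType)
    (S : T -> set X) (r : seq T) (C : set X) :
  set_field G -> (forall t, G (S t)) ->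
  (forall x y, (forall t, t \in r -> S t x <-> S t y) -> C x -> C y) -> G C.
Proof.
move=> Gf GS; elim: r C => [|s r IH] C det.
  have [->|/set0P[x Cx]] := eqVneq C set0; first by case: Gf.
  have -> : C = setT by apply/seteqP; split=> // y _; exact: det Cx.
  exact: set_fieldT.
pose ext (P : set X) : set X :=
  [set x | exists y, [/\ C y, P y & forall t, t \in r -> S t x <-> S t y]].
have Gext P : G (ext P).
  apply: IH => x y xy [z [Cz Pz xz]]; exists z; split=> // t tr.
  by rewrite -xy // xz.
have -> : C = (S s `&` ext (S s)) `|` (~` S s `&` ext (~` S s)).
  apply/seteqP; split=> x.
    move=> Cx; have [Sx|Sx] := pselect (S s x).
      by left; split=> //; exists x; split.
    by right; split=> //; exists x; split.
  case=> -[Sx [y [Cy Sy xy]]]; apply: det Cy => t;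
  rewrite inE => /orP[/eqP->|/xy]; move: Sx Sy; rewrite /setC /=; tauto.
case: (Gf) => _ GU GC; apply: GU; apply: set_fieldI => //; exact: GC.
Qed.

Section FinitelyAdditive.
Context (R : realType) (X : Type) (G : set (set X)) (mu : set X -> R).
Hypothesis muP : fa_prob G mu.

Lemma fa_prob0 : mu set0 = 0.
Proof.
case: muP => -[G0 _ _] _ _ /(_ _ _ G0 G0 (setI0 _)).
by rewrite setU0 -[LHS]addr0 => /addrI.
Qed.

Lemma fa_prob_split A B : G A -> G B -> mu A = mu (A `&` B) + mu (A `\` B).
Proof.
case: muP => Gf _ _ add GA GB; rewrite -add ?setUIDK //.
- exact: set_fieldI.
- exact: set_fieldD.
- by rewrite setDE setIACA setICr setI0.
Qed.

Lemma fa_prob_le A B : G A -> G B -> A `<=` B -> mu A <= mu B.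
Proof.
move=> GA GB AB; rewrite (fa_prob_split GB GA) (setIidr AB) lerDl.
by case: muP => Gf ge0 _ _; apply: ge0; exact: set_fieldD.
Qed.

Lemma fa_prob_le1 A : G A -> mu A <= 1.
Proof.
move=> GA; case: (muP) => Gf _ <- _.
by apply: fa_prob_le => //; exact: set_fieldT.
Qed.

Lemma fa_prob_leY Q A B : G Q -> G A -> G B ->
  mu (Q `&` A) <= mu (Q `&` B) + mu (A `+` B).
Proof.
case: (muP) => Gf _ _ _ GQ GA GB.
have GQA := set_fieldI Gf GQ GA.
rewrite (fa_prob_split GQA GB) lerD // fa_prob_le //.
- exact: set_fieldI.
- exact: set_fieldI.
- by move=> x [[]].
- exact: set_fieldD.
- exact: set_fieldY.
- by move=> x [[_ Ax] Bx]; left.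
Qed.

(** The [S j] may overlap. [A] is cut along each of them in turn, the coefficient [c j] being
    absorbed into the constant [a] on the part inside [S j]; at the end the function is constant on
    each piece. *)
Lemma fa_prob_sum_ge0 (J : Type) (r : seq J) (c : J -> R) (S : J -> set X)
    (a : R) (A : set X) :
  (forall j, G (S j)) -> G A ->
  (forall x, A x -> 0 <= a + \sum_(j <- r) c j * \1_(S j) x) ->
  0 <= a * mu A + \sum_(j <- r) c j * mu (A `&` S j).
Proof.
move=> GS; case: (muP) => Gf ge0 _ _.
elim: r a A => [|s r IH] a A GA pos.
  rewrite big_nil addr0; have [->|/set0P[x Ax]] := eqVneq A set0.
    by rewrite fa_prob0 mulr0.
  by rewrite mulr_ge0 ?ge0 //; have := pos x Ax; rewrite big_nil addr0.
have GI := set_fieldI Gf GA (GS s); have GD := set_fieldD Gf GA (GS s).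
have posI : 0 <= (a + c s) * mu (A `&` S s) +
                 \sum_(j <- r) c j * mu ((A `&` S s) `&` S j).
  apply: IH => // x [Ax Sx]; have := pos x Ax.
  by rewrite big_cons indicE mem_set // mulr1 addrA.
have posD : 0 <= a * mu (A `\` S s) +
                 \sum_(j <- r) c j * mu ((A `\` S s) `&` S j).
  apply: IH => // x [Ax Sx]; have := pos x Ax.
  by rewrite big_cons indicE memNset // mulr0 add0r.
apply: le_trans (addr_ge0 posI posD) _.
rewrite le_eqVlt; apply/orP; left; apply/eqP.
rewrite big_cons [mu A](fa_prob_split GA (GS s)).
have -> : \sum_(j <- r) c j * mu (A `&` S j) =
    \sum_(j <- r) c j * mu ((A `&` S s) `&` S j) +
    \sum_(j <- r) c j * mu ((A `\` S s) `&` S j).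
  rewrite -big_split /=; apply: eq_bigr => j _; rewrite -mulrDr; congr (_ * _).
  by rewrite (fa_prob_split (set_fieldI Gf GA (GS j)) (GS s)) !setDE
    [A `&` S s `&` _]setIAC [A `&` ~` _ `&` _]setIAC.
by ring.
Qed.

Lemma sf_integral_le (s t : simple_fun R G) (c : R) :
  (forall x, sf_eval s x <= sf_eval t x + c) ->
  sf_integral mu s <= sf_integral mu t + c.
Proof.
move=> st; rewrite /sf_integral; case: (muP) => Gf _ mu1 _.
(* The difference of [t] and [s] becomes one sum over the disjoint union of the index types, and
   positivity is applied to it with constant [c]. *)
pose coef (j : 'I_(sf_size t) + 'I_(sf_size s)) :=
  match j with inl i => sf_coef i | inr i => - sf_coef i end.
pose st_set (j : 'I_(sf_size t) + 'I_(sf_size s)) :=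
  match j with inl i => sf_set i | inr i => sf_set i end.
have Gst j : G (st_set j) by case: j => i; exact: sf_setP.
have := @fa_prob_sum_ge0 _ (index_enum _) coef st_set c setT Gst (set_fieldT Gf).
rewrite mu1 mulr1 !big_sumType /=.
under eq_bigr do rewrite setTI; under [X in _ + (_ + X)]eq_bigr do rewrite setTI mulNr.
rewrite sumrN => pos; rewrite -subr_ge0 addrAC addrC; apply: pos => x _.
rewrite big_sumType /=; under [X in _ + (_ + X)]eq_bigr do rewrite mulNr.
by rewrite sumrN addrC addrAC subr_ge0; exact: st.
Qed.

(** The slack [c] turns uniform approximation of integrands into approximation of integrals. *)
Lemma has_integral_le (f g : X -> R) (v w c : R) :
  has_integral G mu f v -> has_integral G mu g w ->
  (forall x, f x <= g x + c) -> v <= w + c.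
Proof.
move=> [s [sf sv]] [t [tg tw]] fg; apply/ler_addgt0Pr => e e0.
(* Four errors: two from approximating [f] and [g], two from approximating their integrals. *)
have e4 : 0 < e / 4 by lra.
near \oo => n.
have sfn : forall x, `|sf_eval (s n) x - f x| < e / 4 by near: n; exact: sf.
have tgn : forall x, `|sf_eval (t n) x - g x| < e / 4 by near: n; exact: tg.
have svn : `|v - sf_integral mu (s n)| < e / 4 by near: n; exact: cvgr_dist_lt.
have twn : `|w - sf_integral mu (t n)| < e / 4 by near: n; exact: cvgr_dist_lt.
have : sf_integral mu (s n) <= sf_integral mu (t n) + (c + e / 2).
  apply: sf_integral_le => x; move: (sfn x) (tgn x) (fg x).
  by rewrite !ltr_norml => /andP[? ?] /andP[? ?] ?; lra.
by move: svn twn; rewrite !ltr_norml => /andP[? ?] /andP[? ?] ?; lra.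
Unshelve. all: by end_near.
Qed.

Lemma has_integral_sum (J : Type) (r : seq J) (c : J -> R) (S : J -> set X) :
  (forall j, G (S j)) ->
  has_integral G mu (fun x => \sum_(j <- r) c j * \1_(S j) x)
    (\sum_(j <- r) c j * mu (S j)).
Proof.
move=> GS.
pose s : simple_fun R G :=
  SimpleFun (fun i => c (tnth (in_tuple r) i)) (fun i => GS (tnth (in_tuple r) i)).
exists (fun=> s); split=> [e e0|].
  by near=> n => x; rewrite /sf_eval /= [X in _ - X]big_tnth subrr normr0.
rewrite big_tnth; exact: cvg_cst.
Unshelve. all: by end_near.
Qed.

End FinitelyAdditive.

(** * Fibres of a hypergraph over prefixes *)

Lemma asboolY (X : Type) (A B : set X) (x : X) :
  `[< (A `+` B) x >] = (`[< A x >] != `[< B x >]).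
Proof.
apply/asboolP/idP => [[[Ax nBx]|[Bx nAx]]|].
- by rewrite (asboolT Ax) (asboolF nBx).
- by rewrite (asboolT Bx) (asboolF nAx).
- by case: asboolP => Ax; case: asboolP => Bx // _; [left|right].
Qed.

Lemma vc_dim_leS (X : Type) (F G : set (set X)) (d : nat) :
  F `<=` G -> vc_dim_le G d -> vc_dim_le F d.
Proof.
move=> FG vcG n S Sn shF; apply: vcG Sn _ => S' /shF[A FA AS].
by exists A => //; exact: FG.
Qed.

(** This is the case [m = 2] in which [fap] is applied to distances between fibres. *)
Lemma bool_comb2Y (X : Type) (G : set (set X)) (A B : set X) :
  G A -> G B -> bool_comb_of_at_most 2 G (A `+` B).
Proof.
move=> GA GB; pose S (i : 'I_2) := if i == ord0 then A else B.
exists 2%N, S; split=> //.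
  by move=> _ [i _ <-]; rewrite /S; case: ifP.
apply: (@set_fieldY _ (smallest _ _)); first exact: set_field_smallest.
  by apply: sub_gen_smallest; exists ord0.
by apply: sub_gen_smallest; exists (lift ord0 ord0).
Qed.

Lemma bool_comb1 (X : Type) (G : set (set X)) (A : set X) :
  G A -> finite_bool_comb G A.
Proof.
move=> GA; exists 1%N, 1%N, (fun=> A); split=> //.
  by move=> _ [i _ <-].
by apply: sub_gen_smallest; exists ord0.
Qed.

Section Coordinates.
Context (k : nat) (V : 'I_k -> Type).
Implicit Types (x y z : forall i, V i).

(** Points of partial products are represented by full points, so that gluing a point of the first
    [j] factors to one of the other factors involves no dependent casts. *)
Definition mix (j : nat) z x : forall i, V i :=
  fun i => if (i < j)%N then z i else x i.

Lemma eq_restr (I : {set 'I_k}) x y :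
  restr I x = restr I y <-> forall i, i \in I -> x i = y i.
Proof.
split=> [xy i iI|xy].
  by have := congr1 (fun u : subprod V I => u (exist _ i iI)) xy.
by apply: functional_extensionality_dep => -[i iI]; exact: xy.
Qed.

(** [x0] supplies the coordinates outside [I]. Hence inclusions of sets in a partial product can be
    checked on restrictions of full points. *)
Lemma restr_surj (I : {set 'I_k}) (x0 : forall i, V i) (u : subprod V I) :
  exists z, u = restr I z.
Proof.
exists (fun i => match @idP (i \in I) with
                 | ReflectT iI => u (exist _ i iI)
                 | ReflectF _ => x0 i
                 end).
apply: functional_extensionality_dep => -[i iI]; rewrite /restr /=.
by case: {-}_ / idP => // iI'; rewrite (bool_irrelevance iI' iI).
Qed.

Lemma mix_dfwith (i : 'I_k) x z (y : V i) :
  mix i z (dfwith x i y) = dfwith (mix i z x) i y.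
Proof.
apply: functional_extensionality_dep => l; rewrite /mix.
have [<-|il] := eqVneq i l; first by rewrite !dfwithin ltnn.
by rewrite !dfwithout.
Qed.

Lemma mixS_dfwith (i : 'I_k) x z (y : V i) :
  mix i.+1 (dfwith z i y) x = dfwith (mix i z x) i y.
Proof.
apply: functional_extensionality_dep => l; rewrite /mix.
have [<-|il] := eqVneq i l; first by rewrite !dfwithin ltnSn.
by rewrite !dfwithout // ltnS leq_eqVlt val_eqE eq_sym (negbTE il).
Qed.

Lemma fibre_prefix (i : 'I_k) (D : set (subprod V (prefix_set k i.+1)))
    (y : V i) z :
  fibre (@prefix_init k V i) (@prefix_last k V i) D y (restr _ z) <->
  D (restr _ (dfwith z i y)).
Proof.
split=> [[t [Dt lty] itz]|Dz].
  suff -> : restr (prefix_set k i.+1) (dfwith z i y) = t by [].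
  apply: functional_extensionality_dep => -[l lP]; rewrite /restr /=.
  have [il|il] := eqVneq i l.
    case: _ / il lP => lP; rewrite dfwithin -lty /prefix_last.
    by rewrite (bool_irrelevance lP (mem_prefix_setS i)).
  rewrite dfwithout //.
  have lP' : l \in prefix_set k i.
    by move: lP; rewrite !inE ltnS leq_eqVlt val_eqE eq_sym (negbTE il).
  have /esym := congr1 (fun u : subprod V _ => u (exist _ l lP')) itz.
  rewrite /restr /prefix_init /subrestr /= => ->.
  by congr (t (exist _ _ _)); exact: bool_irrelevance.
exists (restr _ (dfwith z i y)).
  by split=> //; rewrite /prefix_last /restr /= dfwithin.
apply: functional_extensionality_dep => -[l lP].
rewrite /prefix_init /subrestr /restr /= dfwithout //.
by apply/eqP => il; move: lP; rewrite -il inE ltnn.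
Qed.

Definition prefix_box (A : forall i, set (V i)) (j : nat) :
    set (subprod V (prefix_set k j)) :=
  [set u | forall i, A (sval i) (u i)].
Arguments prefix_box A j _ : clear implicits.

Lemma prefix_boxP (A : forall i, set (V i)) (j : nat) z :
  prefix_box A j (restr _ z) <-> forall i : 'I_k, (i < j)%N -> A i (z i).
Proof.
split=> [Az i ij|Az [i iP]]; last by apply: Az; have := iP; rewrite inE.
have iP : i \in prefix_set k j by rewrite inE.
exact: Az (exist _ i iP).
Qed.

End Coordinates.
Arguments prefix_box {k V} A j _.

Section Fibres.
Context (k : nat) (V : 'I_k -> Type) (E : set (forall i, V i)).
Context (x0 : forall i, V i).
Implicit Types (x z : forall i, V i).

(** The section of [E] in the first [j] factors, indexed by a full point [x] whose coordinates from
    [j] on are the ones that are fixed. *)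
Definition prefix_fibre (j : nat) x : set (subprod V (prefix_set k j)) :=
  fibre_on E (prefix_set k j) (restr _ x).
Arguments prefix_fibre j x _ : clear implicits.

Lemma prefix_fibreP (j : nat) x z :
  prefix_fibre j x (restr _ z) <-> E (mix j z x).
Proof.
split=> [[t [Et /eq_restr tx] /eq_restr tz]|Ez].
  suff -> : mix j z x = t by [].
  apply: functional_extensionality_dep => i; rewrite /mix.
  by case: ifP => ij; [rewrite tz|rewrite tx]; rewrite ?inE ?ij.
exists (mix j z x); last by apply/eq_restr => i; rewrite /mix !inE => ->.
by split=> //; apply/eq_restr => i; rewrite /mix !inE => /negbTE ->.
Qed.

Lemma fibre_atP (i : 'I_k) x (y : V i) :
  fibre_at E i (restr _ x) y <-> E (dfwith x i y).
Proof.
split=> [[t [Et /eq_restr tx] ty]|Ey].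
  suff -> : dfwith x i y = t by [].
  apply: functional_extensionality_dep => l.
  have [<-|il] := eqVneq i l; first by rewrite dfwithin.
  by rewrite dfwithout // tx // !inE eq_sym.
exists (dfwith x i y); last exact: dfwithin.
by split=> //; apply/eq_restr => l; rewrite !inE eq_sym => il; rewrite dfwithout.
Qed.

(** Slicing a section of [E] gives a section with one factor less; the induction over prefixes rests
    on this. *)
Lemma fibre_prefix_fibre (i : 'I_k) x (y : V i) :
  fibre (@prefix_init k V i) (@prefix_last k V i) (prefix_fibre i.+1 x) y =
  prefix_fibre i (dfwith x i y).
Proof.
by apply/seteqP; split=> u; have [z ->] := restr_surj x0 u;
  rewrite fibre_prefix !prefix_fibreP mixS_dfwith mix_dfwith.
Qed.

Lemma fibre_prefix_fibreY (i : 'I_k) x x' (y : V i) :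
  fibre (@prefix_init k V i) (@prefix_last k V i)
    (prefix_fibre i.+1 x `+` prefix_fibre i.+1 x') y =
  prefix_fibre i (dfwith x i y) `+` prefix_fibre i (dfwith x' i y).
Proof.
by apply/seteqP; split=> u; have [z ->] := restr_surj x0 u;
  rewrite fibre_prefix /= !prefix_fibreP !mixS_dfwith !mix_dfwith.
Qed.

Lemma prefix_boxS (A : forall i, set (V i)) (i : 'I_k) :
  prefix_box A i.+1 =
  box (@prefix_init k V i) (@prefix_last k V i) (prefix_box A i) (A i).
Proof.
apply/seteqP; split=> u; have [z ->] := restr_surj x0 u.
  move=> /prefix_boxP Az; split; last exact: Az.
  by apply/(prefix_boxP A) => l li; apply: Az; exact: ltnW.
move=> [/(prefix_boxP A) Az Ai]; apply/prefix_boxP => l.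
rewrite ltnS leq_eqVlt => /orP[/eqP/val_inj ->//|]; exact: Az.
Qed.

Lemma eq_prefix_box (A A' : forall i, set (V i)) (j : nat) :
  (forall i : 'I_k, (i < j)%N -> A i = A' i) -> prefix_box A j = prefix_box A' j.
Proof.
move=> AA'; apply/seteqP; split=> u; have [z ->] := restr_surj x0 u;
by move=> /prefix_boxP Az; apply/prefix_boxP => i ij; move: (Az i ij); rewrite AA'.
Qed.

Lemma definable_at_determined (i : 'I_k) (T : finType) (b : T -> forall i, V i)
    (C : set (V i)) :
  (forall y y', (forall t, E (dfwith (b t) i y) <-> E (dfwith (b t) i y')) ->
     C y -> C y') ->
  definable_at E i C.
Proof.
move=> det; exists #|T|, #|T|, (fun t => fibre_at E i (restr _ (b (enum_val t)))).
split=> //; first by move=> _ [t _ <-]; eexists.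
apply: (@set_field_determined _ _ T
  (fun t => fibre_at E i (restr _ (b t))) (enum T)).
- exact: set_field_smallest.
- move=> t; apply: sub_gen_smallest; exists (enum_rank t) => //.
  by rewrite enum_rankK.
- move=> y y' yy'; apply: det => t.
  by rewrite -!fibre_atP; apply: yy'; rewrite mem_enum.
Qed.

Lemma definable_at_sub (i : 'I_k) (G : set (set (V i))) :
  set_field G -> range (fibre_at E i) `<=` G -> definable_at E i `<=` G.
Proof.
move=> Gf EG C [m [n [S [_ SE SC]]]]; apply: SC; split=> //.
exact: subset_trans SE EG.
Qed.

End Fibres.
Arguments prefix_fibre {k V} E j x _.

(** * Dense boxes *)

(** The hypotheses of the theorem with the fields [F] and measures [M] on prefixes exposed, since
    the induction runs over prefixes. *)
Record vc_product (R : realType) (k d : nat) (V : 'I_k -> Type)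
    (E : set (forall i, V i)) (B : forall i, set (set (V i)))
    (mu : forall i, set (V i) -> R)
    (F : forall j : nat, set (set (subprod V (prefix_set k j))))
    (M : forall j : nat, set (subprod V (prefix_set k j)) -> R) : Prop :=
  VcProduct {
    vcp_vc : hypergraph_vc_dim_le E d;
    vcp_fibre : forall i, range (fibre_at E i) `<=` B i;
    vcp_prob : forall i, fa_prob (B i) (mu i);
    vcp_fap : forall i, fap E (mu i);
    vcp_F0 : F 0%N = setT;
    vcp_prob0 : fa_prob (F 0%N) (M 0%N);
    vcp_FS : forall i : 'I_k,
      F i.+1 = ltimes_field (@prefix_init k V i) (@prefix_last k V i)
                 (definable_on E (prefix_set k i.+1)) (F i) (B i);
    vcp_ltimes : forall i : 'I_k,
      is_ltimes (@prefix_init k V i) (@prefix_last k V i)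
        (definable_on E (prefix_set k i.+1))
        (F i) (M i) (B i) (mu i) (M i.+1) }.

Section VcProduct.
Context (R : realType) (k d : nat) (V : 'I_k -> Type).
Context (E : set (forall i, V i)) (B : forall i, set (set (V i))).
Context (mu : forall i, set (V i) -> R).
Context (F : forall j : nat, set (set (subprod V (prefix_set k j)))).
Context (M : forall j : nat, set (subprod V (prefix_set k j)) -> R).
Context (x0 : forall i, V i).
Arguments B : clear implicits.
Arguments mu : clear implicits.
Arguments F : clear implicits.
Arguments M : clear implicits.
Hypothesis EP : vc_product d E B mu F M.
Implicit Types (x z : forall i, V i).

Lemma vcp_field (i : 'I_k) : set_field (B i).
Proof. by case: (vcp_prob EP i). Qed.

Lemma vcp_measurable_definable (i : 'I_k) (C : set (V i)) :
  definable_at E i C -> B i C.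
Proof.
apply: definable_at_sub; first exact: vcp_field.
exact: (@vcp_fibre _ _ _ _ _ _ _ _ _ EP).
Qed.

Lemma vcp_prob_prefix (j : nat) : (j <= k)%N -> fa_prob (F j) (M j).
Proof.
case: j => [_|j jk]; first exact: vcp_prob0 EP.
have [+ _ _] := vcp_ltimes EP (Ordinal jk).
by rewrite -(vcp_FS EP (Ordinal jk)).
Qed.

Lemma vcp_measurable_fibre (j : nat) x : (j <= k)%N -> F j (prefix_fibre E j x).
Proof.
case: j => [_|j jk]; first by rewrite (vcp_F0 EP).
rewrite (vcp_FS EP (Ordinal jk)); apply: sub_gen_smallest; left.
by apply: bool_comb1; eexists.
Qed.

Lemma vcp_measurable_box (A : forall i, set (V i)) (j : nat) : (j <= k)%N ->
  (forall i : 'I_k, (i < j)%N -> B i (A i)) -> F j (prefix_box A j).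
Proof.
elim: j => [_ _|j IH jk BA]; first by rewrite (vcp_F0 EP).
rewrite (prefix_boxS x0 A (Ordinal jk)) (vcp_FS EP (Ordinal jk)).
apply: sub_gen_smallest; right; exists (prefix_box A j), (A (Ordinal jk)).
split=> //; last exact: BA.
by apply: IH; [exact: ltnW|move=> i ij; apply: BA; exact: ltnW].
Qed.

Lemma vcp_integral_fibre (i : 'I_k) x (Q : set (subprod V (prefix_set k i)))
    (C : set (V i)) :
  F i Q -> B i C ->
  has_integral (B i) (mu i)
    (fun y => \1_C y * M i (Q `&` prefix_fibre E i (dfwith x i y)))
    (M i.+1 (prefix_fibre E i.+1 x `&`
             box (@prefix_init k V i) (@prefix_last k V i) Q C)).
Proof.
move=> FQ BC; have [_ _ int] := vcp_ltimes EP i.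
have D : definable_on E (prefix_set k i.+1) (prefix_fibre E i.+1 x).
  by apply: bool_comb1; eexists.
have := int _ Q C D FQ BC; congr (has_integral _ _ _ _).
by apply/funext => y; rewrite fibre_prefix_fibre.
Qed.

Lemma vcp_integral_fibreY (i : 'I_k) x x' :
  has_integral (B i) (mu i)
    (fun y => M i (prefix_fibre E i (dfwith x i y) `+`
                   prefix_fibre E i (dfwith x' i y)))
    (M i.+1 (prefix_fibre E i.+1 x `+` prefix_fibre E i.+1 x')).
Proof.
have [_ _ int] := vcp_ltimes EP i.
have FT : F i setT by apply: set_fieldT; case: (vcp_prob_prefix (ltnW (ltn_ord i))).
have D : definable_on E (prefix_set k i.+1)
           (prefix_fibre E i.+1 x `+` prefix_fibre E i.+1 x').
  by exists 2%N; apply: bool_comb2Y; eexists.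
have := int _ setT setT D FT (set_fieldT (vcp_field i)).
rewrite {1}/box !preimage_setT setTI setIT.
congr (has_integral _ _ _ _).
by apply/funext => y; rewrite indicT mul1r setTI fibre_prefix_fibreY.
Qed.

(** Finite approximation passes to products, uniformly in [x] and [x']. The sample for [j.+1] is the
    product of the one for [j] with one for [mu i]: the count approximating the slices is
    integrated, and each measure in the result is again approximated by a count. *)
Lemma vcp_fap_prefix (j : nat) (e : R) : (j <= k)%N -> 0 < e ->
  exists (T : finType) (P : T -> forall i, V i), (0 < #|T|)%N /\
    forall x x', `|M j (prefix_fibre E j x `+` prefix_fibre E j x') -
      #|[pred t | `[< E (mix j (P t) x) >] != `[< E (mix j (P t) x') >]]|%:R
        / #|T|%:R| < e.
Proof.
elim: j e => [|j IH] e jk e0.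
  (* The empty product has one point, so the symmetric difference is everything or nothing and a
     one-point sample is exact. *)
  exists unit, (fun=> x0); split=> [|x x']; first by rewrite card_unit.
  have [_ _ M1 _] := vcp_prob0 EP.
  rewrite card_unit divr1 /=.
  set D := _ `+` _; set c := _ != _ => /=.
  have DE u : D u <-> c.
    have [z ->] := restr_surj x0 u; rewrite /D /c.
    have mixE y : mix 0 z y = mix 0 x0 y by [].
    rewrite -!mixE -!(asbool_equiv_eq (prefix_fibreP _ _ _ _)) -asboolY.
    by split=> /asboolP.
  case: (boolP c) DE => cT DE.
    have -> : D = setT by apply/seteqP; split=> // u _; apply/DE.
    by rewrite M1 (eq_card (B := predT)) ?card_unit ?subrr ?normr0.
  have -> : D = set0 by apply/seteqP; split=> // u /DE.
  by rewrite (fa_prob0 (vcp_prob0 EP)) (eq_card (B := pred0)) ?card0 ?subrr ?normr0.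
pose i := Ordinal jk; have e3 : 0 < e / 3 by lra.
have [T [P [T0 PP]]] := IH _ (ltnW jk) e3.
have [n [q [n0 qP]]] := vcp_fap EP i 2 e3.
exists (T * 'I_n)%type, (fun p => dfwith (P p.1) i (q p.2)).
split=> [|x x']; first by rewrite card_prod card_ord muln_gt0 T0.
(* [D t] consists of the [y] for which the sample point [P t] separates the two slices at [y]. *)
pose D t := fibre_at E i (restr _ (mix j (P t) x)) `+`
            fibre_at E i (restr _ (mix j (P t) x')).
have BD t : B i (D t).
  by apply: set_fieldY; [exact: vcp_field|apply: (vcp_fibre EP); eexists..].
have DE t y : `[< D t y >] =
    (`[< E (mix j (P t) (dfwith x i y)) >] != `[< E (mix j (P t) (dfwith x' i y)) >]).
  by rewrite asboolY !(asbool_equiv_eq (fibre_atP _ _ _)) !(@mix_dfwith _ _ i).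
have intf := @vcp_integral_fibreY i x x'.
have intg := @has_integral_sum _ _ _ (mu i) _ (index_enum T)
               (fun=> #|T|%:R^-1) D BD.
have TR0 : 0 < #|T|%:R :> R by rewrite ltr0n.
have nR0 : 0 < n%:R :> R by rewrite ltr0n.
have fg y : `|M i (prefix_fibre E i (dfwith x i y) `+`
                   prefix_fibre E i (dfwith x' i y)) -
              \sum_(t : T) #|T|%:R^-1 * \1_(D t) y| < e / 3.
  have := PP (dfwith x i y) (dfwith x' i y); congr (`|_ - _| < _).
  rewrite -mulr_sumr mulrC; congr (_ * _).
  rewrite -sum1_card natr_sum big_mkcond /=; apply: eq_bigr => t _.
  by rewrite indicE [y \in D t]DE inE; case: ifP.
(* Replacing the slices by their sampled measures costs [e / 3], and sampling [mu i] another
   [e / 3]. *)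
have le1 := has_integral_le (vcp_prob EP i) intf intg (c := e / 3).
have le2 := has_integral_le (vcp_prob EP i) intg intf (c := e / 3).
set cnt := #|_|; set s := \sum_(t : T) _ in le1 le2.
have cntE : cnt = (\sum_(t : T) #|[pred l | q l \in D t]|)%N.
  rewrite /cnt -sum1_card big_mkcond /=.
  under [RHS]eq_bigr do rewrite -sum1_card big_mkcond /=.
  rewrite pair_big /=; apply: eq_bigr => -[t l] _.
  by rewrite !inE [q l \in D t]DE /= !(@mixS_dfwith _ _ i) !(@mix_dfwith _ _ i).
have -> : cnt%:R / #|{: T * 'I_n}|%:R =
    \sum_(t : T) #|T|%:R^-1 * (#|[pred l | q l \in D t]|%:R / n%:R) :> R.
  rewrite -mulr_sumr -mulr_suml -natr_sum -cntE card_prod card_ord natrM invfM.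
  by rewrite mulrCA.
have : `|s - \sum_(t : T) #|T|%:R^-1 * (#|[pred l | q l \in D t]|%:R / n%:R)| <= e / 3.
  rewrite -sumrB; apply: le_trans (ler_norm_sum _ _ _) _.
  apply: (@le_trans _ _ (\sum_(t : T) #|T|%:R^-1 * (e / 3))).
    apply: ler_sum => t _; rewrite -mulrBr normrM gtr0_norm ?invr_gt0 //.
    by rewrite ler_pM2l ?invr_gt0 // ltW // qP //; apply: bool_comb2Y; eexists.
  by rewrite sumr_const -[_ *+ _]mulr_natr mulrAC mulVf ?mul1r // gt_eqF.
have {}le1 : M i.+1 (prefix_fibre E i.+1 x `+` prefix_fibre E i.+1 x') <= s + e / 3.
  by apply: le1 => y; have := fg y; rewrite ltr_norml => /andP[? ?]; lra.
have {}le2 : s <= M i.+1 (prefix_fibre E i.+1 x `+` prefix_fibre E i.+1 x') + e / 3.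
  by apply: le2 => y; have := fg y; rewrite ltr_norml => /andP[? ?]; lra.
by rewrite ler_norml => /andP[? ?]; rewrite ltr_norml; apply/andP; split; lra.
Qed.

(** The density is multiplied out to avoid a quotient. [A] is a family over all coordinates, so that
    [dfwith] can extend a box by one factor. *)
Definition dense_box (j : nat) x (eps delta : R) : Prop :=
  exists A : forall i, set (V i),
    [/\ forall i, definable_at E i (A i),
        forall i : 'I_k, (i < j)%N -> delta < mu i (A i) &
        (1 - eps) * \prod_(i < k | (i < j)%N) mu i (A i) <
          M j (prefix_fibre E j x `&` prefix_box A j)].

Lemma dense_box0 x (eps delta : R) : 0 < eps ->
  0 < M 0 (prefix_fibre E 0 x) -> dense_box 0 x eps delta.
Proof.
(* No coordinate lies below 0: the box is the whole one-point product, and [set0] is a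
   placeholder. *)
move=> eps0 M0; exists (fun=> set0); split=> //.
  by move=> i; apply: (@definable_at_determined _ _ _ _ unit (fun=> x)).
rewrite big_pred0 // mulr1.
have [u Eu] : exists u, prefix_fibre E 0 x u.
  apply: contrapT => noE; move: M0; rewrite (_ : prefix_fibre E 0 x = set0).
    by rewrite (fa_prob0 (vcp_prob0 EP)) ltxx.
  by apply/seteqP; split=> // u Eu; case: noE; exists u.
have one u' : u' = u.
  apply: functional_extensionality_dep => -[i iP].
  by have := iP; rewrite inE.
rewrite (_ : _ `&` _ = setT).
  by have [_ _ -> _] := vcp_prob0 EP; rewrite ltrBlDr ltrDl.
apply/seteqP; split=> // u' _; rewrite (one u'); split=> // -[i iP].
by have := iP; rewrite inE.
Qed.

(* The [y] whose fibre agrees with that of [z] up to [e] on the sample [P]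
   form a definable set: it only depends on the fibres over the sample. *)
Definition sample_ball (i : 'I_k) (T : finType) (P : T -> forall i, V i)
    (e : R) x (z : V i) : set (V i) :=
  [set y | ~~ sample_separated e (fun t => restr (prefix_set k i) (P t))
               (fun y => prefix_fibre E i (dfwith x i y)) y z].

Lemma definable_sample_ball (i : 'I_k) (T : finType) (P : T -> forall i, V i)
    (e : R) x (z : V i) : definable_at E i (sample_ball P e x z).
Proof.
apply: (@definable_at_determined _ _ _ _ T (fun t => mix i (P t) x)) => y y' yy'.
rewrite /sample_ball /=; congr (~~ (_ <= _%:R)); apply: eq_card => t.
rewrite !inE; congr (_ != _); apply: asbool_equiv_eq.
by rewrite !prefix_fibreP !mix_dfwith.
Qed.

(** The bound [alpha / 12] on [e] serves to find a large ball with a good centre, the bound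
    [eps * delta ^+ k / 4] to keep the density. Covering is a premise so that [N] can be fixed
    before the hypergraph. *)
Lemma dense_box_step (i : 'I_k) (N : nat) (alpha eps delta e : R) :
  0 < alpha -> 0 < eps -> 0 < delta -> delta <= 1 -> 0 < e ->
  e <= alpha / 12 -> e <= eps * delta ^+ k / 4 ->
  (forall (X Y : Type) (T : finType) (P : T -> X) (S : Y -> set X),
     (0 < #|T|)%N -> vc_dim_le (range S) d ->
     exists (n : nat) (z : 'I_n -> Y), (n <= N)%N /\
       forall y, exists l, ~~ sample_separated e P S y (z l)) ->
  (forall x, alpha / 3 <= M i (prefix_fibre E i x) ->
     dense_box i x (eps / 2) delta) ->
  forall x, alpha <= M i.+1 (prefix_fibre E i.+1 x) ->
    dense_box i.+1 x eps (Num.min delta (alpha / (4 * N.+1%:R))).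
Proof.
move=> alpha0 eps0 delta0 delta1 e0 e_alpha e_eps cover IH x alphaM.
have ik : (i <= k)%N := ltnW (ltn_ord i).
have [Ff M_ge0 M1 _] := vcp_prob_prefix ik.
pose S y := prefix_fibre E i (dfwith x i y).
have FS y : F i (S y) by exact: vcp_measurable_fibre.
have vcS : vc_dim_le (range S) d.
  apply: (@vc_dim_leS _ _ (range (fibre_on E (prefix_set k i)))).
    by move=> _ [y _ <-]; eexists.
  exact: (vcp_vc EP).
have [T [P [T0 PP]]] := vcp_fap_prefix ik e0.
have [n [z [nN zcov]]] := cover _ _ _ (fun t => restr (prefix_set k i) (P t)) _ T0 vcS.
pose C l := sample_ball P e x (z l).
have BC l : B i (C l).
  by apply: vcp_measurable_definable; exact: definable_sample_ball.
(* The radius of the ball and the sampling error contribute [e] each. *)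
have near_centre l y : C l y -> M i (S y `+` S (z l)) < e + e.
  rewrite /C /sample_ball /sample_separated /= -ltNge => sep.
  have := PP (dfwith x i y) (dfwith x i (z l)).
  rewrite ltr_norml => /andP[_]; rewrite ltrBlDr; move=> /lt_trans; apply.
  rewrite ltrD2l ltr_pdivrMr ?ltr0n //; apply: le_lt_trans sep.
  rewrite ler_nat subset_leq_card //; apply/fintype.subsetP => t; rewrite !inE.
  by rewrite !(asbool_equiv_eq (prefix_fibreP _ _ _ _)).
(* Otherwise the balls with good centres contribute at most [alpha / 4] and the other [y] at most
   [alpha / 3 + (e + e)], in total at most three quarters of [alpha]. *)
have [l [good_l mu_l]] : exists l,
    alpha / 3 <= M i (S (z l)) /\ alpha / (4 * N.+1%:R) < mu i (C l).
  apply: contrapT => no_l.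
  pose g l : R := (alpha / 3 <= M i (S (z l)))%R%:R.
  have intf := vcp_integral_fibre x (set_fieldT Ff) (set_fieldT (vcp_field i)).
  have intg := @has_integral_sum _ _ _ (mu i) _ (index_enum 'I_n) g C BC.
  rewrite {1}/box !preimage_setT setTI setIT in intf.
  have : M i.+1 (prefix_fibre E i.+1 x) <=
         \sum_(l < n) g l * mu i (C l) + (alpha / 3 + (e + e)).
    apply: (has_integral_le (vcp_prob EP i) intf intg) => y.
    rewrite indicT mul1r setTI -/(S y).
    have g_ge0 l : 0 <= g l * \1_(C l) y by rewrite mulr_ge0 // ler0n.
    have [l yl] := zcov y; rewrite (bigD1 l) //= indicE mem_set // mulr1.
    have ge0 : 0 <= \sum_(l0 < n | l0 != l) g l0 * \1_(C l0) y.
      by apply: sumr_ge0.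
    rewrite /g; case: (lerP (alpha / 3) (M i (S (z l)))) => /= Mz.
      have := fa_prob_le1 (vcp_prob_prefix ik) (FS y); lra.
    have := fa_prob_leY (vcp_prob_prefix ik) (set_fieldT Ff) (FS y) (FS (z l)).
    have := near_centre l y yl; rewrite !setTI; lra.
  have : \sum_(l < n) g l * mu i (C l) <= alpha / 4.
    apply: (@le_trans _ _ (\sum_(l < n) alpha / (4 * N.+1%:R))).
      apply: ler_sum => l _; rewrite /g; case: (lerP (alpha / 3)) => /= Mz.
        rewrite mul1r leNgt; apply/negP => mu_l.
        by apply: no_l; exists l.
      by rewrite mul0r divr_ge0 ?mulr_ge0 // ltW.
    rewrite sumr_const card_ord -[_ *+ _]mulr_natr.
    apply: (@le_trans _ _ (alpha / (4 * N.+1%:R) * N.+1%:R)).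
      apply: ler_wpM2l; first by rewrite divr_ge0 ?mulr_ge0 // ltW.
      by rewrite ler_nat leqW.
    by rewrite invfM mulrA divfK ?pnatr_eq0.
  lra.
have [A [defA muA densA]] := IH _ good_l.
have BA l' : B l' (A l') by exact: vcp_measurable_definable.
exists (dfwith A i (C l)); split=> [l'|l'|].
- have [<-|il] := eqVneq i l'; last by rewrite dfwithout.
  by rewrite dfwithin; exact: definable_sample_ball.
- rewrite ltnS leq_eqVlt => /orP[/eqP/val_inj ->|li].
    by rewrite dfwithin gt_min mu_l orbT.
  by rewrite dfwithout ?gt_min ?muA // -val_eqE gtn_eqF.
rewrite (prefix_boxS x0) dfwithin (@eq_prefix_box _ _ x0 _ A); last first.
  by move=> l' li; rewrite dfwithout // -val_eqE gtn_eqF.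
set Q := prefix_box A i.
have FQ : F i Q by apply: vcp_measurable_box.
set p := \prod_(l' < k | (l' < i)%N) mu l' (A l') in densA.
have -> : \prod_(l' < k | (l' < i.+1)%N) mu l' (dfwith A i (C l) l') = mu i (C l) * p.
  rewrite (bigD1 i) //= dfwithin; congr (_ * _); apply: eq_big => l'.
    by rewrite ltnS -val_eqE ltn_neqAle andbC.
  by move=> /andP[_ il']; rewrite dfwithout // eq_sym.
(* Factors missing from [p] count as 1, which is at least [delta]. *)
have p_ge : delta ^+ k <= p.
  rewrite /p -[k in delta ^+ k]card_ord -prodr_const [leRHS]big_mkcond /=.
  apply: ler_prod => l' _; rewrite ltW //=; case: ifP => // li.
  by rewrite ltW // muA.
(* A lower bound, valid for all [y] in the ball, for the measure of [S y] inside the box [Q]. *)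
pose c := M i (S (z l) `&` Q) - (e + e).
have intf := vcp_integral_fibre x FQ (BC l).
have intg := @has_integral_sum _ _ _ (mu i) _ [:: tt] (fun=> c) (fun=> C l) (fun=> BC l).
have : c * mu i (C l) <= M i.+1 (prefix_fibre E i.+1 x `&`
    box (@prefix_init k V i) (@prefix_last k V i) Q (C l)).
  rewrite big_seq1 in intg; rewrite -[leRHS]addr0.
  apply: (has_integral_le (vcp_prob EP i) intg intf) => y.
  rewrite big_seq1 addr0 indicE -/(S y).
  have [Cy|Cy] := pselect (C l y); last by rewrite memNset // mulr0 mul0r.
  rewrite mem_set // mulr1 mul1r /c (setIC (S _)).
  have := fa_prob_leY (vcp_prob_prefix ik) FQ (FS (z l)) (FS y).
  by have := near_centre l y Cy; rewrite setYC; lra.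
apply: lt_le_trans; rewrite mulrCA mulrC ltr_pM2r; last first.
  by apply: lt_trans mu_l; rewrite divr_gt0 ?mulr_gt0.
(* The box has density above [1 - eps / 2] at the centre, and [e + e] is at most [eps * p / 2]. *)
have : eps * delta ^+ k <= eps * p by rewrite ler_pM2l.
rewrite /c; move: densA e_eps; rewrite -/(S (z l)) -/Q; lra.
Qed.

End VcProduct.

(** The constants are chosen in the order: [delta] for [j] at [alpha / 3] and [eps / 2], then [e]
    from it, then [N] from [d] and [e], then the new [delta]. All of them precede the hypergraph and
    its measures. *)
Lemma dense_box_exists (R : realType) (k d j : nat) (alpha eps : R) :
  (j <= k)%N -> 0 < alpha -> 0 < eps ->
  exists delta : R, [/\ 0 < delta, delta <= 1 &
    forall (V : 'I_k -> Type) (E : set (forall i, V i))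
           (B : forall i, set (set (V i))) (mu : forall i, set (V i) -> R)
           (F : forall j : nat, set (set (subprod V (prefix_set k j))))
           (M : forall j : nat, set (subprod V (prefix_set k j)) -> R),
      vc_product d E B mu F M ->
      forall x, alpha <= M j (prefix_fibre E j x) ->
        dense_box E mu M j x eps delta].
Proof.
elim: j alpha eps => [|j IH] alpha eps jk alpha0 eps0.
  exists 1; split=> // V E B mu F M EP x alphaM.
  by apply: (dense_box0 EP) => //; exact: lt_le_trans alphaM.
have a3 : 0 < alpha / 3 by lra.
have e2 : 0 < eps / 2 by lra.
have [delta [delta0 delta1 deltaP]] := IH _ _ (ltnW jk) a3 e2.
have dk : 0 < eps * delta ^+ k / 4.
  by rewrite divr_gt0 // mulr_gt0 // exprn_gt0.
pose e := Num.min 1 (Num.min (alpha / 12) (eps * delta ^+ k / 4)).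
have e0 : 0 < e by rewrite !lt_min ltr01 dk andbT /=; lra.
have e1 : e <= 1 by rewrite ge_min lexx.
have [N cover] := vc_cover d e0 e1.
exists (Num.min delta (alpha / (4 * N.+1%:R))); split.
- by rewrite lt_min delta0 divr_gt0 // mulr_gt0.
- by rewrite ge_min delta1.
- move=> V E B mu F M EP x.
  apply: (@dense_box_step _ _ _ _ _ _ _ _ _ x EP (Ordinal jk) N alpha eps delta e) => //.
  + by rewrite !ge_min lexx orbT.
  + by rewrite !ge_min lexx !orbT.
  + exact: deltaP EP.
Qed.

Theorem mainTheorem3 (R : realType) (k d : nat) (alpha eps : R)
    (alpha_gt0 : 0 < alpha) (eps_gt0 : 0 < eps) :
  exists2 delta : R, 0 < delta &
    forall (V : 'I_k -> Type) (E : set (forall i, V i))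
           (B : forall i, set (set (V i))) (mu : forall i, set (V i) -> R)
           (pmu : set (forall i, V i) -> R),
      hypergraph_vc_dim_le E d ->
      (forall i, set_field (B i)) ->
      (forall i, range (fibre_at E i) `<=` B i) ->
      (forall i, fa_prob (B i) (mu i)) ->
      (forall i, fap E (mu i)) ->
      iterated_ltimes E B mu pmu ->
      alpha <= pmu E ->
      exists A : forall i, set (V i),
        [/\ forall i, definable_at E i (A i),
            forall i, delta < mu i (A i) &
            1 - eps < edge_density E mu pmu A].
Proof.
have [delta [delta0 _ deltaP]] := dense_box_exists d (leqnn k) alpha_gt0 eps_gt0.
exists delta => // V E B mu pmu vcE _ fibB muP fapE [F [M [[F0 M0] FM pmuM]]] alphaE.
have EP : vc_product d E B mu F M by split=> // i; case: (FM i).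
(* A base point is needed to fill coordinates; without one, [E] is empty and has measure 0, against
   [alpha > 0]. *)
have [[x0 _]|noX] := pselect (exists x : forall i, V i, True); last first.
  have E0 : E = restr (prefix_set k k) @^-1` set0.
    by apply/seteqP; split=> // x _; case: noX; exists x.
  move: alphaE; rewrite E0 pmuM (fa_prob0 (vcp_prob_prefix EP (leqnn k))).
  by rewrite leNgt alpha_gt0.
(* At [j = k] no coordinate is left to fix, so the section over [x0] is all of [E]. *)
have EE : E = restr (prefix_set k k) @^-1` prefix_fibre E k x0.
  have mixE z : mix k z x0 = z.
    by apply: functional_extensionality_dep => i; rewrite /mix ltn_ord.
  by apply/seteqP; split=> z /=; rewrite prefix_fibreP mixE.
have [|A [defA muA densA]] := deltaP _ _ _ _ _ _ EP x0.
  by rewrite -pmuM -EE.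
exists A; split=> // [i|]; first exact: muA.
rewrite (eq_bigl predT) in densA; last by move=> i; rewrite ltn_ord.
rewrite /edge_density ltr_pdivlMr; last first.
  by apply: prodr_gt0 => i _; apply: lt_trans (muA i _).
rewrite {1}EE (_ : [set x | _] = restr (prefix_set k k) @^-1` prefix_box A k).
  by rewrite -preimage_setI pmuM.
apply/seteqP; split=> z /=; rewrite prefix_boxP => Az i //; exact: Az.
Qed.
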